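(* Let $s \ge 2$ and let $X$ be an $s$-distance set in $\mathbb{R}^d$ with $A(X) = \{\alpha_1, \alpha_2, \ldots, \alpha_s\}$. Let $N = \binom{d+s-1}{s-1} + \binom{d+s-2}{s-2}$. If $|X| \ge 2N$, then for each $i = 1, 2, \ldots, s$ the number \[ k_i = \prod_{j=1,\ldots,s,\ j \neq i} \frac{\alpha_j^2}{\alpha_j^2 - \alpha_i^2} \] is an integer, and $|k_i| \le U(N)$.
   Context: A finite set $X \subset \mathbb{R}^d$ is called an $s$-distance set if $|A(X)| = s$, where $A(X) = \{ d(x,y) : x, y \in X, x \neq y\}$ and $d(x,y)$ is the Euclidean distance. The function $U$ is defined by $U(N) = \left\lfloor \frac{1}{2} + \sqrt{\frac{N^2}{2N-2} + \frac{1}{4}} \right\rfloor$. *)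

(* Defs.v *)
From HB Require Import structures.
From mathcomp Require Import all_boot all_order all_algebra.
From mathcomp Require Import finmap.
From mathcomp Require Import reals.
Set Implicit Arguments. Unset Strict Implicit. Unset Printing Implicit Defensive.
Import Order.TTheory GRing.Theory Num.Theory.
Local Open Scope ring_scope.

Definition edist (R : realType) (d : nat) (x y : 'rV[R]_d) : R :=
  Num.sqrt (\sum_(i < d) (x ord0 i - y ord0 i) ^+ 2).

Definition in_dist_set (R : realType) (d : nat) (X : {fset 'rV[R]_d}) (a : R) : Prop :=
  exists x y, [/\ x \in X, y \in X, x != y & edist x y = a].

Definition Ufun (R : realType) (N : nat) : int :=
  Num.floor (2^-1 + Num.sqrt ((N%:R ^+ 2) / (2 * N%:R - 2) + 4^-1) : R).

(* Main.v *)
(* For each [i], the kernel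
     M(x, y) = \prod_(j != i) (alpha_j^2 - |x - y|^2) / (alpha_j^2 - alpha_i^2)
   restricted to X is k_i I + A, with A the adjacency matrix of the graph of
   pairs at distance alpha_i.  It is a polynomial of degree s - 1 in |x|^2 and the
   coordinates of x, and reducing x_1^2 by means of |x|^2 leaves a space of
   functions of dimension N, so M has rank at most N.  Hence - k_i is an eigenvalue
   of A of multiplicity at least |X| - N >= |X| / 2, so it has degree at most 2
   over the rationals; degree 2 would make the graph regular with its degree a
   root of the minimal polynomial.  So k_i is rational, and integral as an
   eigenvalue of an integer matrix.
   The constants belong to the same function space, so J - 2M has rank at most N
   too; as its off-diagonal entries are all 1 or -1, the inequality
   (tr B)^2 <= rank B * tr (B B^T) gives (2 k_i - 1)^2 <= 2N - 1. *)
Require Import Defs.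
From HB Require Import structures.
From mathcomp Require Import all_boot all_order all_algebra all_field.
From mathcomp Require Import finmap reals boolp.
From mathcomp Require Import ring lra zify.
Set Implicit Arguments. Unset Strict Implicit. Unset Printing Implicit Defensive.
Import Order.TTheory GRing.Theory Num.Theory.
Local Open Scope ring_scope.

(** * Multiplicities of roots of characteristic polynomials *)

(** Sylvester's identity: the block matrix [W] is made triangular in two ways. The powers of [a] on
    both sides avoid comparing [n] with [r]. *)
Lemma det_sub_mulmxC (R : comNzRingType) (n r : nat) (a : R)
    (C : 'M[R]_(n, r)) (U : 'M[R]_(r, n)) :
  \det (a%:M - C *m U) * a ^+ r = \det (a%:M - U *m C) * a ^+ n.
Proof.
pose W := block_mx 1%:M U C a%:M : 'M[R]_(r + n).
have detW : \det W = \det (a%:M - C *m U).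
  have -> : W = block_mx 1%:M 0 C 1%:M *m block_mx 1%:M U 0 (a%:M - C *m U).
    by rewrite mulmx_block !mul1mx !mul0mx !mulmx1 !addr0 [X in block_mx _ _ _ X]addrC subrK.
  by rewrite det_mulmx det_lblock det_ublock !det1 !mul1r.
have : \det (W *m block_mx a%:M 0 (- C) 1%:M) = \det (a%:M - U *m C) * a ^+ n.
  rewrite mulmx_block !mul1mx !mulmx0 !mulmx1 !add0r !mulmxN.
  by rewrite mul_mx_scalar mul_scalar_mx subrr det_ublock det_scalar.
by rewrite det_mulmx det_lblock det1 mulr1 det_scalar detW.
Qed.

(** Factoring [A - a%:M] through its rank [r], Sylvester's identity leaves a determinant of size [r]
    times the stated power. *)
Lemma XsubC_exp_dvd_char_poly (F : fieldType) (n : nat) (A : 'M[F]_n) (a : F) :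
  ('X - a%:P) ^+ (n - \rank (A - a%:M)) %| char_poly A.
Proof.
set B := A - a%:M; set r := \rank B.
have Xa0 : 'X - a%:P != 0 by rewrite polyXsubC_eq0.
have := @det_sub_mulmxC {poly F} n r ('X - a%:P)
  (map_mx polyC (col_base B)) (map_mx polyC (row_base B)).
rewrite -map_mxM mulmx_base /B map_mxB map_scalar_mx opprB.
rewrite raddfB /= addrA subrK.
have -> : ('X - a%:P) ^+ n = ('X - a%:P) ^+ (n - r) * ('X - a%:P) ^+ r.
  by rewrite -exprD subnK ?rank_leq_row.
rewrite mulrA => /(mulIf (expf_neq0 _ Xa0)) Hdet.
by rewrite /char_poly /char_poly_mx Hdet dvdp_mull.
Qed.

(** A nonzero annihilator of least size works: a nonzero remainder modulo it would be a smaller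
    one. *)
Lemma ex_minimal_annihilator (F K : fieldType) (f : {rmorphism F -> K})
    (x : K) (p : {poly F}) :
  p != 0 -> root (map_poly f p) x ->
  exists m : {poly F}, [/\ m \is monic, root (map_poly f m) x
    & forall q, root (map_poly f q) x -> m %| q].
Proof.
move=> p0 px.
pose P n := `[< exists q, [/\ q != 0, root (map_poly f q) x & size q = n] >].
have exP : exists n, P n by exists (size p); apply/asboolP; exists p.
case: (ex_minnP exP) => n /asboolP [m [m0 mx sm]] minn.
have lm0 : lead_coef m != 0 by rewrite lead_coef_eq0.
exists ((lead_coef m)^-1 *: m); split.
- by rewrite monicE lead_coefZ mulVf.
- by rewrite map_polyZ rootE hornerZ (eqP mx) mulr0.
move=> q qx; rewrite dvdpZl ?invr_neq0 //; apply/modp_eq0P/eqP; apply: contraT => r0.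
have : P (size (q %% m)).
  apply/asboolP; exists (q %% m); split=> //.
  move: qx; rewrite {1}(divp_eq q m) rmorphD rmorphM !rootE !hornerE.
  by rewrite (eqP mx) mulr0 add0r.
by move/minn; rewrite -sm leqNgt ltn_modp m0.
Qed.

Lemma size_gt1_map_root (F K : fieldType) (f : {rmorphism F -> K})
    (m : {poly F}) (x : K) :
  m != 0 -> root (map_poly f m) x -> (1 < size m)%N.
Proof.
move=> m0 mx; rewrite ltnNge; apply/negP => /size1_polyC Em; move: m0 mx.
rewrite Em map_polyC /= polyC_eq0 rootE hornerC => c0.
by rewrite fmorph_eq0 (negPf c0).
Qed.

Lemma exp_dvd_of_root_multiplicity (F : numFieldType) (K : fieldType)
    (f : {rmorphism F -> K}) (x : K) (m p : {poly F}) (mu : nat) :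
  m != 0 -> root (map_poly f m) x ->
  (forall q, root (map_poly f q) x -> m %| q) ->
  ('X - x%:P) ^+ mu %| map_poly f p -> m ^+ mu %| p.
Proof.
move=> m0 mx minm.
have [h Eh] := factor_theorem _ _ mx.
have dm0 : m^`() != 0.
  apply/eqP => dm0.
  have sm1 := size_gt1_map_root m0 mx.
  have /eqP : m^`()`_(size m).-2 = 0 by rewrite dm0 coef0.
  rewrite coef_deriv -subn2 subnSK // subn1 mulrn_eq0 -lead_coefE.
  by rewrite lead_coef_eq0 (negPf m0) -subn1 subn_eq0 leqNgt sm1.
have hx : ~~ root h x.
  apply/negP => hx.
  have /minm : root (map_poly f m^`()) x.
    rewrite -deriv_map Eh derivM derivB derivX derivC subr0 mulr1.
    by rewrite rootE hornerD hornerM hornerXsubC subrr mulr0 add0r.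
  by rewrite gtNdvdp // lt_size_deriv.
elim: mu p => [|mu IH] p; first by move=> _; rewrite expr0 dvd1p.
move=> Hp.
have px : root (map_poly f p) x.
  by rewrite root_factor_theorem; apply: dvdp_trans Hp; rewrite exprS dvdp_mulr.
have /dvdpP [g Eg] := minm _ px.
rewrite Eg exprSr dvdp_mul2r //; apply: IH.
have X0 : 'X - x%:P != 0 by rewrite polyXsubC_eq0.
move: Hp; rewrite Eg rmorphM /= Eh mulrA exprSr dvdp_mul2r // Gauss_dvdpl //.
by rewrite coprimep_sym coprimep_expr // coprimep_XsubC.
Qed.

(** * Symmetric matrices, adjacency matrices and integral eigenvalues *)

(** For symmetric [C] the diagonal of [C ^+ 2] holds the squared norms of the rows, so [C ^+ 2 = 0]
    forces [C = 0]. An exponent that is a power of two can be halved repeatedly. *)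
Lemma symmetric_nilpotent_eq0 (F : realFieldType) (n j : nat) (B : 'M[F]_n.+1) :
  B^T = B -> B ^+ j = 0 -> B = 0.
Proof.
move=> symB Bj0.
have {Bj0} : B ^+ (2 ^ j) = 0.
  have le_j : (j <= 2 ^ j)%N by apply/ltnW/ltn_expl.
  by rewrite -(subnKC le_j) exprD Bj0 mul0r.
elim: j => [|j IH]; first by rewrite expn0 expr1.
rewrite expnS mulnC exprM => C2; apply: IH.
set C := B ^+ (2 ^ j) in C2 *.
have symC : C^T = C.
  rewrite /C; elim: (2 ^ j)%N => [|i IHi]; first by rewrite expr0 trmx1.
  by rewrite exprS -[LHS]/((B *m B ^+ i)^T) trmx_mul IHi symB -exprS exprSr.
apply/matrixP => i k.
have : (C ^+ 2) i i = 0 by rewrite C2 mxE.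
rewrite expr2 mxE => /eqP; rewrite psumr_eq0 => [|l _].
  move/allP/(_ k (mem_index_enum _)) => /=.
  by rewrite -{2}symC !mxE -expr2 sqrf_eq0 => /eqP.
by rewrite -{2}symC !mxE -expr2 sqr_ge0.
Qed.

Definition adjmx (K : pzRingType) (n : nat) (e : rel 'I_n) : 'M[K]_n :=
  \matrix_(i, j) (e i j)%:R.

Arguments adjmx K {n} e.

Lemma map_adjmx (K L : pzRingType) (f : {rmorphism K -> L}) (n : nat) (e : rel 'I_n) :
  map_mx f (adjmx K e) = adjmx L e.
Proof. by apply/matrixP => i j; rewrite !mxE rmorph_nat. Qed.

Lemma tr_adjmx (K : pzRingType) (n : nat) (e : rel 'I_n) :
  symmetric e -> (adjmx K e)^T = adjmx K e.
Proof. by move=> symE; apply/matrixP => i j; rewrite !mxE symE. Qed.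

(* The diagonal of [A ^ 2] holds the vertex degrees, so the relation forces the
   graph to be regular; its degree [- c] is then an eigenvalue of [A]. *)
Lemma adjmx_quadratic_root (K : comNzRingType) (n : nat) (e : rel 'I_n.+1) (b c : K) :
  symmetric e -> irreflexive e ->
  adjmx K e ^+ 2 + b *: adjmx K e + c%:M = 0 ->
  (- c) ^+ 2 + b * (- c) + c = 0.
Proof.
move=> symE irrE; set A := adjmx K e => /matrixP A2.
have rowA i : \sum_j A i j = - c.
  have := A2 i i; rewrite expr2 !mxE eqxx irrE mulr0 addr0 mulr1n => /eqP.
  rewrite addr_eq0 => /eqP <-; apply: eq_bigr => j _.
  by rewrite !mxE symE; case: (e j i); rewrite ?mulr1 ?mulr0.
have : \sum_j (A ^+ 2 + b *: A + c%:M) ord0 j = 0.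
  by apply: big1 => j _; rewrite A2 mxE.
under eq_bigr => j _ do rewrite expr2 !mxE.
rewrite !big_split /= -mulr_sumr => H.
rewrite -[RHS]H; congr (_ + _ + _).
- rewrite exchange_big /= expr2 -{1}(rowA ord0) mulr_suml.
  by apply: eq_bigr => j _; rewrite -mulr_sumr rowA.
- by rewrite -(rowA ord0); congr (_ * _); apply: eq_bigr => j _; rewrite mxE.
rewrite (bigD1 ord0) //= mulr1n big1 ?addr0 // => j j0.
by rewrite eq_sym (negPf j0).
Qed.

Lemma rat_root_char_poly_int (n : nat) (A : 'M[int]_n) (x : rat) :
  root (char_poly (map_mx intr A : 'M[rat]_n)) x -> x \is a Num.int.
Proof.
move=> rx; rewrite -Cint_rat; apply: Cint_rat_Aint; first exact: Crat_rat.
apply: (@root_monic_Aint (map_poly intr (char_poly A))).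
- have -> : map_poly (intr : int -> algC) (char_poly A)
      = map_poly ratr (map_poly (intr : int -> rat) (char_poly A)).
    by rewrite -map_poly_comp; apply: eq_map_poly => i /=; rewrite ratr_int.
  by rewrite fmorph_root map_char_poly.
- by apply: monic_map; exact: char_poly_monic.
- by apply/polyOverP => i; rewrite coef_map /= intr_int.
Qed.

(* If [x] is irrational, its minimal polynomial [m] is quadratic and the
   characteristic polynomial of [A] is a power of [m]; then [m(A)] is symmetric
   and nilpotent, hence zero. *)
Lemma adjmx_large_eigenspace_int (R : archiRealFieldType) (n : nat)
    (e : rel 'I_n) (x : R) :
  symmetric e -> irreflexive e -> (0 < n)%N ->
  (n <= 2 * (n - \rank (adjmx R e - x%:M)%R))%N -> x \is a Num.int.
Proof.
case: n e => // n e symE irrE _.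
set mu := (_ - \rank _)%N => le_n_mu.
have mu_gt0 : (0 < mu)%N by case: mu le_n_mu.
pose p := char_poly (adjmx rat e).
have pmu : ('X - x%:P) ^+ mu %| map_poly ratr p.
  rewrite /p map_char_poly map_adjmx; exact: XsubC_exp_dvd_char_poly.
have pm : p \is monic := char_poly_monic _.
have p0 : p != 0 := monic_neq0 pm.
have sp : size p = n.+2 := size_char_poly _.
have px : root (map_poly ratr p) x.
  rewrite root_factor_theorem; apply: dvdp_trans pmu.
  by rewrite -(prednK mu_gt0) exprS dvdp_mulr.
have [m [mm mx minm]] := @ex_minimal_annihilator _ _ (@ratr R) x p p0 px.
have m0 : m != 0 := monic_neq0 mm.
have mp : m ^+ mu %| p.
  exact: (@exp_dvd_of_root_multiplicity _ _ (@ratr R) x).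
have szm := size_gt1_map_root m0 mx.
have smu : size (m ^+ mu) = ((size m).-1 * mu).+1.
  by rewrite -size_exp prednK // lt0n size_poly_eq0 expf_neq0.
have := dvdp_leq p0 mp; rewrite smu sp => le_mu.
suff [y Ey] : exists y, x = ratr y.
  have: y \is a Num.int.
    apply: (@rat_root_char_poly_int _ (adjmx int e)).
    by rewrite map_adjmx -(@fmorph_root _ _ (@ratr R)) /= -Ey.
  by rewrite Ey => /intrP [z ->]; rewrite ratr_int intr_int.
have mE z : (map_poly (@ratr R) m).[z] = \sum_(i < size m) ratr m`_i * z ^+ i.
  by rewrite horner_coef size_map_poly; apply: eq_bigr => i _; rewrite coef_map.
have lm : m`_(size m).-1 = 1 by move/monicP: mm.
(* The degree of [m] times [mu] is at most the order of the matrix, which is at most [2 * mu]. *)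
have sm23 : size m = 2%N \/ size m = 3%N by nia.
case: sm23 => sm; rewrite sm /= in lm.
  exists (- m`_0); move: mx; rewrite rootE mE sm !big_ord_recr big_ord0 /=.
  rewrite lm rmorph1 mul1r add0r expr0 mulr1 expr1 addr_eq0 => /eqP E.
  by rewrite rmorphN /= E opprK.
have Ep : m ^+ mu = p.
  apply/eqP; rewrite -eqp_monic ?monic_exp // -dvdp_size_eqp // smu sp sm /=.
  by apply/eqP; nia.
have mpE : m = 'X^2 + m`_1 *: 'X + (m`_0)%:P.
  apply/polyP => -[|[|[|i]]]; rewrite !coefE /= ?mulr0 ?mulr1 ?addr0 ?add0r //.
  by rewrite nth_default // sm.
have symA := tr_adjmx rat symE.
have mAE : horner_mx (adjmx rat e) m
    = adjmx rat e ^+ 2 + m`_1 *: adjmx rat e + (m`_0)%:M.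
  by rewrite {1}mpE !rmorphD rmorphXn /= linearZ /= horner_mx_X horner_mx_C.
have mA0 : horner_mx (adjmx rat e) m = 0.
  apply: (@symmetric_nilpotent_eq0 _ _ mu).
    rewrite mAE !raddfD /= expr2 -[_ * _]/(_ *m _) trmx_mul linearZ /=.
    by rewrite tr_scalar_mx symA.
  by rewrite -rmorphXn /= Ep Cayley_Hamilton.
have [d d0] : exists d, d ^+ 2 + m`_1 * d + m`_0 = 0.
  by exists (- m`_0); apply: adjmx_quadratic_root symE irrE (etrans (esym mAE) mA0).
have : (x - ratr d) * (x - ratr (- d - m`_1)) = 0.
  have md0 : ratr (d ^+ 2 + m`_1 * d + m`_0) = 0 :> R by rewrite d0 rmorph0.
  move: mx md0; rewrite rootE mE sm !big_ord_recr big_ord0 /= lm.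
  rewrite !rmorphD !rmorphXn !rmorphM !rmorphN !rmorph1 /= => /eqP mx md0.
  move: (ratr m`_0) (ratr m`_1) (ratr d) mx md0 => u v w mx md0.
  transitivity (0 + u * x ^+ 0 + v * x ^+ 1 + 1 * x ^+ 2 - (w ^+ 2 + v * w + u)).
    by ring.
  by rewrite mx md0 subrr.
move/eqP; rewrite mulf_eq0 !subr_eq0 => /orP [] /eqP ->; by eexists.
Qed.

(** * Function spaces on finitely many points *)

(* Row space of the monomials of degree at most [e] in the functions [gs],
   evaluated at [n] points; multiplication by a function [g] is [diag_mx g]. *)
Fixpoint monomials_mx (F : fieldType) (n : nat) (gs : seq 'rV[F]_n) : nat -> 'M[F]_n :=
  if gs is g :: gs' then
    fix mons e := if e is e'.+1
                  then (monomials_mx gs' e + mons e' *m diag_mx g)%MS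
                  else <<const_mx 1 : 'rV_n>>%MS
  else fun=> <<const_mx 1 : 'rV_n>>%MS.

(** Pascal's rule mirrors the split of the monomials by whether they contain the first generator. *)
Lemma rank_monomials_mx (F : fieldType) (n : nat) (gs : seq 'rV[F]_n) (e : nat) :
  (\rank (monomials_mx gs e) <= 'C(size gs + e, e))%N.
Proof.
elim: gs e => [|g gs IH] e; first by rewrite /= mxrank_gen add0n binn rank_leq_row.
elim: e => [|e IHe]; first by rewrite /= mxrank_gen bin0 rank_leq_row.
rewrite /= -/monomials_mx addSn addnS binS -addnS.
apply: leq_trans (mxrank_adds_leqif _ _) _; apply: leq_add => //.
by apply: leq_trans (mxrankM_maxl _ _) _; rewrite addnS -addSn.
Qed.

Lemma const_sub_monomials_mx (F : fieldType) (n : nat) (gs : seq 'rV[F]_n) (e : nat) :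
  ((const_mx 1 : 'rV_n) <= monomials_mx gs e)%MS.
Proof.
elim: gs e => [|g gs IH] [|e] //=; rewrite ?genmxE //.
exact: submx_trans (IH _) (addsmxSl _ _).
Qed.

Lemma monomials_mxS (F : fieldType) (n : nat) (gs : seq 'rV[F]_n) (e : nat) :
  (monomials_mx gs e <= monomials_mx gs e.+1)%MS.
Proof.
elim: gs e => [|g gs IH] e //; elim: e => [|e IHe].
  by rewrite [X in (X <= _)%MS]/= genmxE; apply: const_sub_monomials_mx.
by apply: addsmxS; [exact: IH | exact: submxMr].
Qed.

Lemma monomials_mx_mul (F : fieldType) (n : nat) (gs : seq 'rV[F]_n) (g : 'rV_n)
    (e : nat) :
  g \in gs -> (monomials_mx gs e *m diag_mx g <= monomials_mx gs e.+1)%MS.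
Proof.
elim: gs e => [|g0 gs IH] e //; rewrite inE; case: eqP => [-> _|_ /= ggs].
  exact: addsmxSr.
elim: e => [|e IHe].
  apply: submx_trans (addsmxSl _ _); apply: submx_trans (IH 0%N ggs).
  by apply: submxMr; rewrite [X in (X <= _)%MS]/= genmxE const_sub_monomials_mx.
rewrite [X in (X *m _ <= _)%MS]/= -/monomials_mx addsmxMr.
apply: addsmxS; first exact: IH.
by rewrite -mulmxA diag_mxC mulmxA submxMr.
Qed.

(* Monomials of degree at most [e] in [h :: gs] with degree at most one in [h]. *)
Definition quadric_mx (F : fieldType) (n : nat) (h : 'rV[F]_n) (gs : seq 'rV[F]_n)
    (e : nat) : 'M[F]_n :=
  (monomials_mx gs e +
    (if e is e'.+1 then monomials_mx gs e' *m diag_mx h else 0))%MS.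

Lemma rank_quadric_mx (F : fieldType) (n : nat) (h : 'rV[F]_n) (gs : seq 'rV[F]_n)
    (e : nat) :
  (\rank (quadric_mx h gs e.+1) <=
    'C(size gs + e.+1, e.+1) + 'C(size gs + e, e))%N.
Proof.
apply: leq_trans (mxrank_adds_leqif _ _) _; apply: leq_add.
  exact: rank_monomials_mx.
exact: leq_trans (mxrankM_maxl _ _) (rank_monomials_mx _ _).
Qed.

Lemma const_sub_quadric_mx (F : fieldType) (n : nat) (h : 'rV[F]_n) (gs : seq 'rV[F]_n)
    (e : nat) :
  ((const_mx 1 : 'rV_n) <= quadric_mx h gs e)%MS.
Proof. exact: submx_trans (const_sub_monomials_mx _ _) (addsmxSl _ _). Qed.

Lemma quadric_mxS (F : fieldType) (n : nat) (h : 'rV[F]_n) (gs : seq 'rV[F]_n)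
    (e : nat) :
  (quadric_mx h gs e <= quadric_mx h gs e.+1)%MS.
Proof.
apply: addsmxS; first exact: monomials_mxS.
by case: e => [|e]; rewrite ?sub0mx // submxMr // monomials_mxS.
Qed.

Lemma quadric_mx_mul (F : fieldType) (n : nat) (h : 'rV[F]_n) (gs : seq 'rV[F]_n)
    (g : 'rV_n) (e : nat) :
  g \in gs -> (quadric_mx h gs e *m diag_mx g <= quadric_mx h gs e.+1)%MS.
Proof.
move=> ggs; rewrite addsmxMr; apply: addsmxS; first exact: monomials_mx_mul.
case: e => [|e]; first by rewrite mul0mx sub0mx.
by rewrite -mulmxA diag_mxC mulmxA submxMr // monomials_mx_mul.
Qed.

(** The hypothesis encodes a relation expressing the square of [h] through [gs]; it sends the part
    linear in [h] back to the part free of [h]. *)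
Lemma quadric_mx_mulh (F : fieldType) (n : nat) (h : 'rV[F]_n) (gs : seq 'rV[F]_n)
    (e : nat) :
  (forall e', monomials_mx gs e' *m diag_mx h *m diag_mx h <= monomials_mx gs e'.+2)%MS ->
  (quadric_mx h gs e *m diag_mx h <= quadric_mx h gs e.+1)%MS.
Proof.
move=> hh; rewrite addsmxMr addsmx_sub addsmxSr /=.
case: e => [|e]; first by rewrite mul0mx sub0mx.
exact: submx_trans (hh e) (addsmxSl _ _).
Qed.

(** Every row lies in one [quadric_mx], which also contains the constants; the form with [c] and
    [c'] covers both [M] and [J - 2M]. *)
Lemma rank_distance_polynomial (F : fieldType) (d n : nat) (I : Type) (p : 'I_n -> 'rV[F]_d.+1)
    (J : seq I) (a b : I -> F) (c c' : F) (e : nat) :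
  size J = e.+1 ->
  (\rank (const_mx c + c' *: \matrix_(v, u) \prod_(j <- J)
      (a j + b j * \sum_l (p v ord0 l - p u ord0 l) ^+ 2))%R
    <= 'C(d.+1 + e.+1, e.+1) + 'C(d.+1 + e, e))%N.
Proof.
move=> sJ.
pose x l : 'rV_n := \row_u p u ord0 l.
pose t : 'rV_n := \row_u \sum_l p u ord0 l ^+ 2.
(* The squared norm [t] takes the place of coordinate [ord0], whose square is [t] minus the other
   squares; this keeps [d.+1] generators. *)
pose gs := t :: [seq x (lift ord0 l) | l <- enum 'I_d].
have tgs : t \in gs by rewrite inE eqxx.
have xgs l : x (lift ord0 l) \in gs.
  by rewrite inE; apply/orP; right; apply/mapP; exists l; rewrite ?mem_enum.
have hh e' : (monomials_mx gs e' *m diag_mx (x ord0) *m diag_mx (x ord0)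
    <= monomials_mx gs e'.+2)%MS.
  have -> : monomials_mx gs e' *m diag_mx (x ord0) *m diag_mx (x ord0)
    = monomials_mx gs e' *m diag_mx t
      - \sum_l monomials_mx gs e' *m diag_mx (x (lift ord0 l)) *m diag_mx (x (lift ord0 l)).
    under eq_bigr => l _ do rewrite !mul_mx_diag.
    rewrite !mul_mx_diag; apply/matrixP => i u; rewrite !mxE summxE big_ord_recl.
    under [X in _ - X]eq_bigr => l _ do rewrite !mxE -mulrA -expr2.
    rewrite -mulr_sumr; ring.
  rewrite addmx_sub ?eqmx_opp ?summx_sub // => [|l _].
    exact: submx_trans (monomials_mx_mul _ tgs) (monomials_mxS _ _).
  apply: submx_trans (monomials_mx_mul _ (xgs l)).
  by rewrite submxMr ?monomials_mx_mul.
pose W := quadric_mx (x ord0) gs.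
have Wx l e' : (W e' *m diag_mx (x l) <= W e'.+1)%MS.
  case: (unliftP ord0 l) => [l' ->|->]; first exact: quadric_mx_mul.
  exact: quadric_mx_mulh.
(* Once the square is expanded, each factor is affine in [t] and the coordinates, so it raises the
   degree by one. *)
have rowW v K : (\row_u \prod_(j <- K)
    (a j + b j * \sum_l (p v ord0 l - p u ord0 l) ^+ 2) <= W (size K))%MS.
  elim: K => [|j K IH].
    have -> : \row_u \prod_(j <- [::])
        (a j + b j * \sum_l (p v ord0 l - p u ord0 l) ^+ 2) = const_mx 1 :> 'rV_n.
      by apply/rowP => u; rewrite !mxE big_nil.
    exact: const_sub_quadric_mx.
  set r := \row_u _ in IH.
  have -> : \row_u \prod_(i <- j :: K)
      (a i + b i * \sum_l (p v ord0 l - p u ord0 l) ^+ 2)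
    = (a j + b j * \sum_l p v ord0 l ^+ 2) *: r + b j *: (r *m diag_mx t)
      + \sum_l (- (2 * b j * p v ord0 l)) *: (r *m diag_mx (x l)).
    under [X in _ = _ + X]eq_bigr => l _ do rewrite mul_mx_diag.
    rewrite mul_mx_diag; apply/rowP => u; rewrite !mxE summxE big_cons.
    under [X in _ = _ + X]eq_bigr => l _ do rewrite !mxE.
    set P := \prod_(_ <- _) _.
    have -> : \sum_l (p v ord0 l - p u ord0 l) ^+ 2
        = \sum_l p v ord0 l ^+ 2 + \sum_l p u ord0 l ^+ 2
          - 2 * \sum_l p v ord0 l * p u ord0 l.
      rewrite mulr_sumr -sumrN -!big_split /=; apply: eq_bigr => i _; ring.
    have -> : \sum_i - (2 * b j * p v ord0 i) * (P * p u ord0 i)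
        = - (2 * b j * P * \sum_i p v ord0 i * p u ord0 i).
      rewrite mulr_sumr -sumrN; apply: eq_bigr => i _; ring.
    ring.
  rewrite !addmx_sub ?scalemx_sub ?summx_sub //.
  - exact: submx_trans IH (quadric_mxS _ _ _).
  - exact: submx_trans (submxMr _ IH) (quadric_mx_mul _ _ tgs).
  - move=> l _; rewrite scalemx_sub //.
    exact: submx_trans (submxMr _ IH) (Wx _ _).
have sgs : size gs = d.+1 by rewrite /= size_map size_enum_ord.
have := rank_quadric_mx (x ord0) gs e; rewrite sgs; apply: leq_trans.
apply: mxrankS.
apply/row_subP => v; rewrite linearD linearZ /= addmx_sub ?scalemx_sub //.
  have -> : row v (const_mx c : 'M_n) = c *: (const_mx 1 : 'rV_n).
    by apply/rowP => u; rewrite !mxE mulr1.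
  by rewrite scalemx_sub // const_sub_quadric_mx.
rewrite -sJ.
have -> : row v (\matrix_(v, u) \prod_(j <- J)
      (a j + b j * \sum_l (p v ord0 l - p u ord0 l) ^+ 2))
   = \row_u \prod_(j <- J) (a j + b j * \sum_l (p v ord0 l - p u ord0 l) ^+ 2).
  by apply/rowP => u; rewrite !mxE.
exact: rowW.
Qed.

(** * Trace, rank and the bound on the eigenvalue *)

Lemma mxtrace_mulmx_tr (F : comPzRingType) (m n : nat) (A : 'M[F]_(m, n)) :
  \tr (A *m A^T) = \sum_i \sum_j A i j ^+ 2.
Proof.
apply: eq_bigr => i _; rewrite mxE; apply: eq_bigr => j _.
by rewrite mxE expr2.
Qed.

(** If [v] kills the Gram matrix, then [v *m U] has squared norm zero. *)
Lemma gram_unitmx (F : realFieldType) (m n : nat) (U : 'M[F]_(m, n)) :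
  row_free U -> U *m U^T \in unitmx.
Proof.
move=> fU; rewrite -row_free_unit; apply: inj_row_free => v /(congr1 (mulmx^~ v^T)).
rewrite mul0mx mulmxA -mulmxA -trmx_mul => /(congr1 mxtrace).
rewrite mxtrace_mulmx_tr mxtrace0 => /eqP; rewrite psumr_eq0 => [/allP vU|i _]; last first.
  by apply: sumr_ge0 => j _; apply: sqr_ge0.
apply: (row_free_inj fU); rewrite mul0mx; apply/matrixP => i j.
have := vU i (mem_index_enum _); rewrite psumr_eq0 => [/allP vUi|k _]; last exact: sqr_ge0.
by have := vUi j (mem_index_enum _); rewrite sqrf_eq0 mxE => /eqP ->; rewrite mxE.
Qed.

(* With [P] the orthogonal projection onto the row space, [\tr B] is the
   Frobenius product of [B] and [P], and [\tr (P *m P^T)] is the rank. *)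
Lemma mxtrace_sqr_le_rank (F : realFieldType) (n N : nat) (B : 'M[F]_n) :
  (0 < N)%N -> (\rank B <= N)%N -> (\tr B) ^+ 2 <= N%:R * \tr (B *m B^T).
Proof.
move=> N0 rN.
have [U [fU [C CU]]] : exists U : 'M_(\rank B, n), row_free U /\ exists C, C *m U = B.
  exists (row_base B); split; first exact: row_base_free.
  by exists (col_base B); rewrite mulmx_base.
pose G := U *m U^T; have Gu : G \in unitmx by apply: gram_unitmx.
have GT : (invmx G)^T = invmx G by rewrite trmx_inv trmx_mul trmxK.
pose P := U^T *m invmx G *m U.
have PT : P^T = P by rewrite /P !trmx_mul trmxK GT mulmxA.
have PP : P *m P = P.
  by rewrite /P -!mulmxA (mulmxA U) -/G (mulmxA G) mulmxV // mul1mx.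
have BP : B *m P = B.
  by rewrite -[X in X *m P]CU /P -!mulmxA (mulmxA U) -/G (mulmxA G) mulmxV // mul1mx.
have trP : \tr P = (\rank B)%:R.
  by rewrite /P mxtrace_mulC mulmxA -/G mulmxV // mxtrace1.
have N0' : 0 < N%:R :> F by rewrite ltr0n.
(* This value maximizes [2 * s * \tr B - s ^+ 2 * N%:R], the lower bound for [\tr (B *m B^T)] given
   by the next inequality. *)
pose s := \tr B / N%:R.
have : 0 <= \tr ((B - s *: P) *m (B - s *: P)^T).
  rewrite mxtrace_mulmx_tr; do 2!apply: sumr_ge0 => ? _; exact: sqr_ge0.
have -> : (B - s *: P)^T = B^T - s *: P by rewrite linearB linearZ /= PT.
rewrite mulmxBr !mulmxBl -!scalemxAl -!scalemxAr PP BP.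
have PBT : P *m B^T = B^T by rewrite -PT -trmx_mul BP.
rewrite PBT !linearB /= !linearZ /= trP mxtrace_tr => H.
have le_r : (\rank B)%:R <= N%:R :> F by rewrite ler_nat.
have Es : \tr B = s * N%:R by rewrite /s divfK // gt_eqF.
rewrite Es in H *; nra.
Qed.

(** The diagonal entries of [B] are [1 - 2 * k] and the others are 1 or -1, so the trace inequality
    becomes explicit; a factor [n] cancels. *)
Lemma adjmx_eigenvalue_bound (F : realFieldType) (n N : nat) (e : rel 'I_n) (k : F) :
  irreflexive e -> (0 < N)%N ->
  (\rank (const_mx 1 + (-2) *: (k%:M + adjmx F e))%R <= N)%N -> (0 < n)%N ->
  (2 * k - 1) ^+ 2 * n%:R <= N%:R * ((2 * k - 1) ^+ 2 + n%:R - 1).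
Proof.
move=> irrE N0 rB n0; set B := const_mx 1 + _ in rB.
have Bd i : B i i = - (2 * k - 1) by rewrite !mxE eqxx irrE mulr1n addr0; ring.
have Bo i j : j != i -> B i j ^+ 2 = 1.
  move=> ji; rewrite !mxE eq_sym (negPf ji) add0r.
  by case: (e i j); rewrite /= ?mulr0 ?mulr1 ?addr0 ?expr1n //; ring.
have := mxtrace_sqr_le_rank N0 rB; rewrite mxtrace_mulmx_tr.
have -> : \tr B = - (2 * k - 1) * n%:R.
  by rewrite /mxtrace (eq_bigr _ (fun i _ => Bd i)) sumr_const card_ord mulr_natr.
have -> : \sum_i \sum_j B i j ^+ 2 = ((2 * k - 1) ^+ 2 + n%:R - 1) * n%:R.
  rewrite mulr_natr -[n in RHS]card_ord -sumr_const; apply: eq_bigr => i _.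
  rewrite (bigD1 i) //= Bd sqrrN -addrA; congr (_ + _).
  rewrite (eq_bigr _ (fun j => @Bo i j)) sumr_const cardC1 card_ord.
  by rewrite -{2}(prednK n0) -natr1 addrK.
rewrite exprMn sqrrN mulrA expr2 mulrA ler_pM2r ?ltr0n //.
Qed.

Lemma Ufun_bound (R : realType) (n N : nat) (k : R) :
  (1 < N)%N -> (2 * N <= n)%N -> k \is a Num.int ->
  (2 * k - 1) ^+ 2 * n%:R <= N%:R * ((2 * k - 1) ^+ 2 + n%:R - 1) ->
  `|k| <= (Ufun R N)%:~R.
Proof.
move=> N1 nN /intrP [z ->]; set q := _ ^+ 2 => Hq.
rewrite -intr_norm ler_int /Ufun floor_ge_int intr_norm.
have N1' : 2 <= N%:R :> R by rewrite (ler_nat _ 2).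
have nN' : 2 * N%:R <= n%:R :> R by rewrite -natrM ler_nat.
(* The hypothesis reads [q * (n - N) <= N * (n - 1)], and [(2 * N - 1) * (n - N) - N * (n - 1) = (N
   - 1) * (n - 2 * N)] is nonnegative. *)
have q_le : q <= 2 * N%:R - 1.
  have : (q - (2 * N%:R - 1)) * (n%:R - N%:R) <= 0 by nra.
  by rewrite pmulr_lle0; lra.
set r := Num.sqrt _.
(* The left side is [q / 4], at most [N / 2 - 1 / 4], which lies below the radicand of [Ufun]. *)
have : (z%:~R - 2^-1) ^+ 2 <= r ^+ 2.
  have Npos : 0 < 2 * N%:R - 2 :> R by lra.
  have Nle : N%:R / 2 <= N%:R ^+ 2 / (2 * N%:R - 2) :> R.
    by rewrite ler_pdivlMr //; nra.
  rewrite sqr_sqrtr; last by nra.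
  by rewrite /q in q_le; nra.
rewrite -real_normK ?num_real // ler_sqr ?nnegrE ?sqrtr_ge0 ?normr_ge0 // => H.
have := ler_normD (z%:~R - 2^-1) (2^-1 : R); rewrite subrK.
have -> : `|2^-1 : R| = 2^-1 by rewrite ger0_norm ?invr_ge0.
lra.
Qed.

(** * The kernel of a distance set *)

Theorem theorem3p1 (R : realType) (d s : nat) (X : {fset 'rV[R]_d})
  (alpha : 'I_s -> R) :
  (2 <= s)%N ->
  injective alpha ->
  (forall a : R, in_dist_set X a <-> exists i, alpha i = a) ->
  (2 * ('C(d + s - 1, s - 1) + 'C(d + s - 2, s - 2)) <= #|` X|)%N ->
  forall i : 'I_s,
    let k := \prod_(j < s | j != i) (alpha j ^+ 2 / (alpha j ^+ 2 - alpha i ^+ 2)) in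
    k \is a Num.int /\
    `|k| <= (Ufun R ('C(d + s - 1, s - 1) + 'C(d + s - 2, s - 2)))%:~R.
Proof.
case: s alpha => [|[|s]] // alpha _ inj_alpha distX.
rewrite !addnS !subn1 !subn2 /= -!addnS.
set N := (_ + _)%N => cardX i; set k := \prod_(_ < _ | _) _.
have N1 : (1 < N)%N.
  by apply: (@leq_add 1 1); rewrite bin_gt0 leq_addl.
pose n := #|` X|.
pose p (u : 'I_n) : 'rV_d := nth 0 X u.
have pX u : p u \in X by apply: mem_nth; exact: ltn_ord.
have inj_p : injective p.
  by move=> u v /eqP; rewrite nth_uniq ?fset_uniq ?ltn_ord // => /eqP /val_inj.
have n_gt1 : (1 < n)%N by apply: leq_trans cardX; lia.
(* In dimension zero there is only one point, while [X] has at least two; otherwise a first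
   coordinate exists. *)
case: d X distX @N cardX N1 @n p pX inj_p n_gt1 => [|d] X distX N cardX N1 n p pX inj_p n_gt1.
  have : Ordinal n_gt1 = Ordinal (ltnW n_gt1).
    by apply: inj_p; apply/rowP => -[].
  by move/(congr1 val).
have n_gt0 := ltnW n_gt1.
(* Distances are nonnegative, so distinct ones have distinct squares and the denominators do not
   vanish. *)
have alpha_ge0 j : 0 <= alpha j.
  have /distX [x [y [_ _ _ <-]]] : exists l, alpha l = alpha j by exists j.
  exact: sqrtr_ge0.
have alpha_neq j : j != i -> alpha j ^+ 2 - alpha i ^+ 2 != 0.
  rewrite subr_eq0; apply: contra.
  by rewrite eqrXn2 ?alpha_ge0 // => /eqP /inj_alpha ->.
pose e : rel 'I_n := fun u v => (u != v) && (edist (p u) (p v) == alpha i).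
have sqr_edist u v : edist (p u) (p v) ^+ 2 = \sum_l (p u ord0 l - p v ord0 l) ^+ 2.
  by rewrite sqr_sqrtr // sumr_ge0 // => l _; apply: sqr_ge0.
have symE : symmetric e.
  move=> u v; rewrite /e eq_sym; congr (_ && (_ == _)).
  by congr Num.sqrt; apply: eq_bigr => l _; rewrite -sqrrN opprB.
have irrE : irreflexive e by move=> u; rewrite /e eqxx.
pose J := [seq j <- enum 'I_s.+2 | j != i].
have sizeJ : size J = s.+1.
  have := cardC1 i; rewrite card_ord cardE /=; apply: etrans.
  by rewrite /J enumT /enum_mem; congr size; apply: eq_filter.
pose b j := - (alpha j ^+ 2 - alpha i ^+ 2)^-1.
pose a j := alpha j ^+ 2 / (alpha j ^+ 2 - alpha i ^+ 2).
(* At distance 0 the product is [k]; at distance [alpha i] every factor is 1; at any other [alpha l]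
   the factor of index [l] vanishes. *)
have ME : \matrix_(u, v) \prod_(j <- J)
    (a j + b j * \sum_l (p u ord0 l - p v ord0 l) ^+ 2) = k%:M + adjmx R e.
  apply/matrixP => u v; rewrite !mxE -sqr_edist big_filter big_enum_cond /=.
  have [<-|neq_uv] := eqVneq u v.
    rewrite irrE mulr1n addr0 /k; apply: eq_bigr => j _.
    rewrite sqr_edist big1 ?mulr0 ?addr0 // => l _; by rewrite subrr expr0n.
  rewrite mulr0n add0r /e neq_uv /=.
  have [l El] : exists l, alpha l = edist (p u) (p v).
    by apply/distX; exists (p u), (p v); rewrite inj_eq.
  rewrite -El (inj_eq inj_alpha); have [->|neq_li] := eqVneq l i.
    by apply: big1 => j /alpha_neq Hj; rewrite /a /b; field.
  rewrite (bigD1 l) //= [X in X * _](_ : _ = 0) ?mul0r //.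
  by have := alpha_neq _ neq_li; rewrite /a /b => Hl; field.
(* Used with [0, 1] for the eigenspace of [- k], and with [1, -2] for the trace bound. *)
have rankM c c' : (\rank (const_mx c + c' *: (k%:M + adjmx R e))%R <= N)%N.
  by rewrite -ME; apply: rank_distance_polynomial.
have k_int : k \is a Num.int.
  rewrite -[k]opprK rpredN; apply: (adjmx_large_eigenspace_int symE irrE) => //.
  have := rankM 0 1; rewrite scale1r.
  have -> : const_mx 0 + (k%:M + adjmx R e) = adjmx R e - (- k)%:M.
    by apply/matrixP => u v; rewrite !mxE; case: eqP => _; ring.
  have arith r l m : (2 * m <= l -> r <= m -> l <= 2 * (l - r))%N by lia.
  exact: arith cardX.
split=> //; apply: (@Ufun_bound _ n) => //.
exact: adjmx_eigenvalue_bound irrE (ltnW N1) (rankM _ _) n_gt0.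
Qed.
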